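(* Let $N\in2\mathbb{N}$ be positive, $M\ge2$, $\alpha>0$ and $C>0$. There exists a constant $C'>0$, depending only on $N$, $M$, $\alpha$ and $C$, such that the following holds. Let $u\in\mathbb{C}^N$ be a signal satisfying the decay assumptions $$|\hat u(\xi)|\le\frac{C}{|\xi|^\alpha}\quad\text{and}\quad|\hat u'(\xi)|\le\frac{C}{|\xi|^\alpha}\qquad\text{for all }\xi\in[-N/2,N/2[\,\setminus\{0\},$$ and let $\Xi=(\xi_1,\dots,\xi_M)\in[-N/2,N/2[^M$ be a configuration of pairwise distinct points. Then for every $m\in\{1,\dots,M\}$ with $\xi_m\neq0$, $$\left|\frac{\partial J_1(\Xi)}{\partial\xi_m}\right|\le C'\,\frac{\|\hat u(\Xi)\|_1}{\mathrm{md}(\Xi)\,|\xi_m|^\alpha}.$$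
   Context: $N$ is a positive even integer and $\mathcal N=\{-N/2,\dots,N/2-1\}$; vectors $u\in\mathbb{C}^N$ are indexed by $n\in\mathcal N$. For $\xi\in\mathbb{R}$, $\hat u(\xi)=\frac{1}{\sqrt N}\sum_{n\in\mathcal N}u_n e^{-2\iota\pi\xi n/N}$ ($\iota$ the imaginary unit), and $\hat u'$ is its derivative in $\xi$. For $\Xi\in\mathbb{R}^M$, $A(\Xi)\in\mathbb{C}^{N\times M}$ has entries $A(\Xi)_{n,m}=\frac{1}{\sqrt N}e^{2\iota\pi\xi_m n/N}$ and $\hat u(\Xi)=A(\Xi)^*u=(\hat u(\xi_1),\dots,\hat u(\xi_M))$. Torus distance: $\mathrm{dist}(\xi,\xi')=\inf_{k\in\mathbb{Z}}|\xi-\xi'-kN|$; min distance: $\mathrm{md}(\Xi)=\min_{m\ne m'}\mathrm{dist}(\xi_m,\xi_{m'})$. Back-projection cost function: $J_1(\Xi)=\mathbb{E}_w\big(\tfrac12\|A(\Xi)(A(\Xi)^*u+w)-u\|_2^2\big)$, where $w\sim\mathcal N(0,\sigma^2\mathrm{Id})$ is white Gaussian noise on $\mathbb{C}^M$ ($\mathbb{E}w=0$, $\mathbb{E}(ww^* )=\sigma^2\mathrm{Id}$), $\sigma\ge0$. *)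

(* Defs.v *)
From HB Require Import structures.
From mathcomp Require Import all_boot all_order all_algebra.
From mathcomp Require Import all_classical all_reals all_analysis.
From mathcomp.real_closed Require Import complex.

Set Implicit Arguments.
Unset Strict Implicit.
Unset Printing Implicit Defensive.

Import Order.TTheory GRing.Theory Num.Theory.
Import numFieldNormedType.Exports.

Local Open Scope classical_set_scope.
Local Open Scope ring_scope.
Local Open Scope complex_scope.

Section complex_vectors.
Context {R : realType}.

(* exp (i t) *)
Definition expi (t : R) : R[i] := cos t +i* sin t.

(* The R-valued modulus; the norm [`|z|] of R[i] is R[i]-valued. *)
Definition cabs (z : R[i]) : R := ComplexField.Normc.normc z.

Definition adjmx m n (A : 'M[R[i]]_(m, n)) : 'M[R[i]]_(n, m) :=
  (map_mx (@conjc R) A)^T.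

Definition norm1 n (v : 'cV[R[i]]_n) : R := \sum_k cabs (v k 0).

Definition norm2 n (v : 'cV[R[i]]_n) : R := Num.sqrt (\sum_k cabs (v k 0) ^+ 2).

(* Derivative of a complex-valued function of a real variable. *)
Definition cderive (f : R -> R[i]) (x : R) : R[i] :=
  derive1 (fun t => complex.Re (f t)) x +i* derive1 (fun t => complex.Im (f t)) x.

End complex_vectors.

Section fourier.
Context {R : realType} {N : nat}.
Implicit Types (u : 'cV[R[i]]_N) (x : R).

(* A vector of C^N is stored with indices 0, ..., N - 1; storage index k stands
   for n = k - N/2, which ranges over {-N/2, ..., N/2 - 1} (N even). *)
Definition freq (k : 'I_N) : R := (k : nat)%:R - (N./2)%:R.

Definition uhat u x : R[i] :=
  ((Num.sqrt N%:R)^-1)%:C *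
    \sum_(k < N) u k 0 * expi (- (2 * pi * x * freq k / N%:R)).

Definition samp_mx M (Xi : 'rV[R]_M) : 'M[R[i]]_(N, M) :=
  \matrix_(k, m) (((Num.sqrt N%:R)^-1)%:C *
                  expi (2 * pi * Xi 0 m * freq k / N%:R)).

Definition uhat_vec M (Xi : 'rV[R]_M) u : 'cV[R[i]]_M :=
  adjmx (samp_mx Xi) *m u.

End fourier.

Section torus.
Context {R : realType}.

Definition torus_dist (N : nat) (x y : R) : R :=
  inf [set `|x - y - k%:~R * N%:R| | k in [set: int]].

(* The set is finite, and nonempty for M >= 2, so this infimum is a minimum. *)
Definition min_dist (N M : nat) (Xi : 'rV[R]_M) : R :=
  inf [set torus_dist N (Xi 0 p.1) (Xi 0 p.2) |
        p in [set p : 'I_M * 'I_M | p.1 != p.2]].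

End torus.

Section noise.
Context {R : realType} {d : measure_display} {T : measurableType d}.
Variable P : probability T R.

(* The complex random matrix X has expectation A, entrywise. The expectations
   are compared in \bar R, so this includes the integrability of X when X is
   measurable. *)
Definition has_expectation m n (X : T -> 'M[R[i]]_(m, n)) (A : 'M[R[i]]_(m, n)) :=
  forall k l, ('E_P[fun t => complex.Re (X t k l)] = (complex.Re (A k l))%:E)%E /\
              ('E_P[fun t => complex.Im (X t k l)] = (complex.Im (A k l))%:E)%E.

(* The normal law of mean mu and standard deviation |s|; [normal_prob] is not
   the point mass when s = 0. *)
Definition normal_law (mu s : R) (B : set R) : \bar R :=
  if s == 0 then \d_mu B else normal_prob mu s B.

(* A random vector of C^M is Gaussian if all its real-linear functionals, which
   are the t |-> Re (a^* w(t)), are (possibly degenerate) normal variables. *)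
Definition gaussian_vector M (w : T -> 'cV[R[i]]_M) :=
  [/\ forall m, measurable_fun setT (fun t => complex.Re (w t m 0)),
      forall m, measurable_fun setT (fun t => complex.Im (w t m 0)) &
      forall a : 'cV[R[i]]_M, exists mu s : R,
        forall B : set R, measurable B ->
          P ((fun t => complex.Re ((adjmx a *m w t) 0 0)) @^-1` B) = normal_law mu s B].

Definition white_gaussian_noise M (sigma : R) (w : T -> 'cV[R[i]]_M) :=
  [/\ gaussian_vector w,
      has_expectation w 0 &
      has_expectation (fun t => w t *m adjmx (w t)) ((sigma ^+ 2)%:C)%:M].

Definition J1 N M (w : T -> 'cV[R[i]]_M) (u : 'cV[R[i]]_N) (Xi : 'rV[R]_M) : R :=
  fine ('E_P[fun t => (2^-1 *
    norm2 (samp_mx Xi *m (adjmx (samp_mx Xi) *m u + w t) - u) ^+ 2)%R])%E.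

End noise.

Definition partial_at {R : realType} M (f : 'rV[R]_M -> R) (Xi : 'rV[R]_M)
  (m : 'I_M) : R := 'D_(delta_mx 0 m) f Xi.

(* Main.v *)
Require Import Defs.
From HB Require Import structures.
From mathcomp Require Import all_boot all_order all_algebra.
From mathcomp Require Import all_classical all_reals all_analysis.
From mathcomp.real_closed Require Import complex.
From mathcomp Require Import measurable_realfun ring lra.

Import Order.TTheory GRing.Theory Num.Theory.
Import numFieldNormedType.Exports.

Local Open Scope classical_set_scope.
Local Open Scope ring_scope.
Local Open Scope complex_scope.

Set Implicit Arguments.
Unset Strict Implicit.

(** The noise is centred and white and the columns of A(Xi) are unit vectors, so
    that expanding the square shows the noise to contribute a constant:
      J1(Xi) = (|b|^2 + sigma^2 M) / 2   with   b = A(Xi) A(Xi)^* u - u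
    (J1E, which rests on expectation_sqr_norm2).

    Moving the point xi_m alone moves only the column a_m of A(Xi) and the sample
    v_m = uhat(xi_m), hence (is_derive_J1)
      dJ1/dxi_m = Re (<b, a_m'> v_m + <b, a_m> v_m').
    The part A(Xi) v of b, with v = A(Xi)^* u, is a combination of unit vectors
    with coefficients v, and <u, a_m>, <u, a_m'> are the conjugates of v_m, v_m'.
    Since |a_m| = 1 and |a_m'| <= pi, the two pairings are bounded
    (residual_pairing_le) by
      |<b, a_m'>| <= pi |v|_1 + |v_m'|   and   |<b, a_m>| <= |v|_1 + |v_m|,
    so every term of the derivative contains both a factor |v|_1, up to
    |v_m| <= |v|_1, and a factor controlled by the decay C / |xi_m|^alpha. This
    gives |dJ1/dxi_m| <= (3 + pi) (C / |xi_m|^alpha) |v|_1 (dcost_le).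

    The minimal distance enters only through 0 < md(Xi) <= N (min_dist_itv), which
    allows 1 to be replaced by N / md(Xi). The strict positivity matters: with
    the convention 1/0 = 0 the right-hand side would otherwise vanish. *)

(** * Complex numbers *)

Section ComplexModulus.
Context {R : realType}.
Implicit Types (z : R[i]) (x : R).

Lemma cabsE z : (cabs z)%:C = `|z|.
Proof. by []. Qed.

Lemma cabs_ge0 z : 0 <= cabs z.
Proof. by case: z => a b; exact: sqrtr_ge0. Qed.

Lemma cabsM (z1 z2 : R[i]) : cabs (z1 * z2) = cabs z1 * cabs z2.
Proof. exact: ComplexField.Normc.normcM. Qed.

Lemma cabs_conj z : cabs (conjc z) = cabs z.
Proof. by case: z => a b; rewrite /cabs /= sqrrN. Qed.

Lemma cabsN z : cabs (- z) = cabs z.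
Proof. exact: normcN. Qed.

Lemma cabsD_le (z1 z2 : R[i]) : cabs (z1 + z2) <= cabs z1 + cabs z2.
Proof. exact: le_normcD. Qed.

Lemma cabs_sum_le (I : Type) (r : seq I) (Q : pred I) (F : I -> R[i]) :
  cabs (\sum_(i <- r | Q i) F i) <= \sum_(i <- r | Q i) cabs (F i).
Proof.
elim/big_ind2: _ => [|z1 x1 z2 x2 h1 h2|//].
  by rewrite /cabs ComplexField.Normc.normc0.
exact: le_trans (cabsD_le _ _) (lerD h1 h2).
Qed.

Lemma cabs_real x : cabs x%:C = `|x|.
Proof. by rewrite /cabs /= expr0n /= addr0 sqrtr_sqr. Qed.

Lemma cabs_expi x : cabs (expi x) = 1.
Proof. by rewrite /cabs /= cos2Dsin2 sqrtr1. Qed.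

Lemma Re_le_cabs z : `|complex.Re z| <= cabs z.
Proof. by rewrite -lecR cabsE; exact: normc_ge_Re. Qed.

Lemma sqr_cabs z : cabs z ^+ 2 = complex.Re (z * conjc z).
Proof.
case: z => a b; rewrite /cabs /= sqr_sqrtr ?addr_ge0 ?sqr_ge0//.
by rewrite mulrN opprK !expr2.
Qed.

Lemma conj_expi x : conjc (expi x) = expi (- x).
Proof. by rewrite /expi /= cosN sinN. Qed.

Lemma Re_sum (I : Type) (r : seq I) (Q : pred I) (F : I -> R[i]) :
  complex.Re (\sum_(i <- r | Q i) F i) = \sum_(i <- r | Q i) complex.Re (F i).
Proof.
apply: (big_morph (@complex.Re R) (id1 := 0) (op1 := +%R)) => // z1 z2.
by case: z1; case: z2.
Qed.

Lemma sqr_norm2 n (v : 'cV[R[i]]_n) :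
  norm2 v ^+ 2 = \sum_k complex.Re (v k 0 * conjc (v k 0)).
Proof.
rewrite /norm2 sqr_sqrtr; last by apply: sumr_ge0 => k _; exact: sqr_ge0.
by apply: eq_bigr => k _; exact: sqr_cabs.
Qed.

End ComplexModulus.

(** * The noise averages out *)

Section Mean.
Context {R : realType} {d : measure_display} {T : measurableType d}.
Variable P : probability T R.

(** Integrability is part of the notion, so that means can be added without side
    conditions. *)
Definition has_mean (f : T -> R) (a : R) :=
  P.-integrable setT (EFin \o f) /\ (\int[P]_t (f t)%:E)%E = a%:E.

Lemma has_mean_cst a : has_mean (fun=> a) a.
Proof.
split; first exact: finite_measure_integrable_cst.
by rewrite integral_cst//= probability_setT mule1.
Qed.

Lemma has_meanD f g a b :
  has_mean f a -> has_mean g b -> has_mean (fun t => f t + g t) (a + b).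
Proof.
move=> [fi fa] [gi gb]; split.
  exact: (integrableD measurableT fi gi).
by rewrite integralD_EFin// fa gb.
Qed.

Lemma has_meanZ f a k : has_mean f a -> has_mean (fun t => k * f t) (k * a).
Proof.
move=> [fi fa]; split.
  exact: (integrableZl measurableT k fi).
under eq_integral do rewrite EFinM.
by rewrite integralZl// fa.
Qed.

Definition has_cmean (X : T -> R[i]) (z : R[i]) :=
  has_mean (@complex.Re R \o X) (complex.Re z) /\
  has_mean (@complex.Im R \o X) (complex.Im z).

Lemma has_cmean_cst z : has_cmean (fun=> z) z.
Proof. by split; exact: has_mean_cst. Qed.

Lemma has_cmeanD X Y x y :
  has_cmean X x -> has_cmean Y y -> has_cmean (fun t => X t + Y t) (x + y).
Proof.
move=> [Xr Xi] [Yr Yi]; split.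
- rewrite (_ : complex.Re (x + y) = complex.Re x + complex.Re y);
    last by case: x {Xr Xi} => ? ?; case: y {Yr Yi}.
  rewrite (_ : _ \o _ = (fun t => complex.Re (X t) + complex.Re (Y t)));
    last by apply/funext => t /=; case: (X t) => ? ?; case: (Y t).
  exact: has_meanD.
- rewrite (_ : complex.Im (x + y) = complex.Im x + complex.Im y);
    last by case: x {Xr Xi} => ? ?; case: y {Yr Yi}.
  rewrite (_ : _ \o _ = (fun t => complex.Im (X t) + complex.Im (Y t)));
    last by apply/funext => t /=; case: (X t) => ? ?; case: (Y t).
  exact: has_meanD.
Qed.

Lemma has_cmeanM X x z : has_cmean X x -> has_cmean (fun t => z * X t) (z * x).
Proof.
case: z => a b [Xr Xi]; split.
- rewrite (_ : complex.Re _ = a * complex.Re x + (- b) * complex.Im x);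
    last by case: x {Xr Xi} => ? ? /=; rewrite mulNr.
  rewrite (_ : _ \o _ =
      (fun t => a * complex.Re (X t) + (- b) * complex.Im (X t)));
    last by apply/funext => t /=; case: (X t) => ? ? /=; rewrite mulNr.
  by apply: has_meanD; exact: has_meanZ.
- rewrite (_ : complex.Im _ = a * complex.Im x + b * complex.Re x);
    last by case: x {Xr Xi}.
  rewrite (_ : _ \o _ = (fun t => a * complex.Im (X t) + b * complex.Re (X t)));
    last by apply/funext => t /=; case: (X t).
  by apply: has_meanD; exact: has_meanZ.
Qed.

Lemma has_cmean_sum n (X : 'I_n -> T -> R[i]) x :
  (forall i, has_cmean (X i) (x i)) ->
  has_cmean (fun t => \sum_i X i t) (\sum_i x i).
Proof.
elim: n X x => [|n IHn] X x Xx.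
  rewrite big_ord0 (_ : (fun _ => _) = (fun=> 0)); first exact: has_cmean_cst.
  by apply/funext => t; rewrite big_ord0.
rewrite big_ord_recl (_ : (fun _ => _) =
    (fun t => X ord0 t + \sum_i X (lift ord0 i) t)).
  by apply: has_cmeanD => //; apply: IHn.
by apply/funext => t; rewrite big_ord_recl.
Qed.

Lemma has_cmean_conj X x :
  has_cmean X x -> has_cmean (fun t => conjc (X t)) (conjc x).
Proof.
move=> [Xr Xi]; split.
- rewrite (_ : complex.Re _ = complex.Re x); last by case: x {Xr Xi}.
  by rewrite (_ : _ \o _ = @complex.Re R \o X)//; apply/funext => t /=; case: (X t).
- rewrite (_ : complex.Im _ = -1 * complex.Im x);
    last by case: x {Xr Xi} => ? ? /=; rewrite mulN1r.
  rewrite (_ : _ \o _ = (fun t => -1 * complex.Im (X t))); first exact: has_meanZ.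
  by apply/funext => t /=; case: (X t) => ? ? /=; rewrite mulN1r.
Qed.

Lemma integrable_dominated (f g : T -> R) :
  measurable_fun setT f -> (forall t, `|f t| <= g t) ->
  P.-integrable setT (EFin \o g) -> P.-integrable setT (EFin \o f).
Proof.
move=> mf fg; apply: le_integrable => //; first exact/measurable_EFinP.
by move=> t _ /=; rewrite lee_fin (le_trans (fg t))// ler_norm.
Qed.

Variables (M : nat) (sigma : R) (w : T -> 'cV[R[i]]_M).
Hypothesis wn : white_gaussian_noise P sigma w.

Let mRe j : measurable_fun setT (fun t => complex.Re (w t j 0)).
Proof. by case: wn => -[]. Qed.

Let mIm j : measurable_fun setT (fun t => complex.Im (w t j 0)).
Proof. by case: wn => -[]. Qed.

Let covE j l t : (w t *m adjmx (w t)) j l = w t j 0 * conjc (w t l 0).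
Proof. by rewrite mxE big_ord1 !mxE. Qed.

Definition energy j t := complex.Re (w t j 0) ^+ 2 + complex.Im (w t j 0) ^+ 2.

(** The variance is finite, so the energy of each component is integrable; this
    is what makes the linear and bilinear terms in the noise integrable. *)
Lemma integrable_energy j : P.-integrable setT (EFin \o energy j).
Proof.
have mE : measurable_fun setT (energy j).
  by apply: measurable_funD; apply: measurable_funX.
apply/integrableP; split; first exact/measurable_EFinP.
case: wn => _ _ /(_ j j)[+ _]; rewrite unlock => E.
rewrite (_ : (\int[P]_x _)%E = (sigma ^+ 2)%:E) ?ltry//.
rewrite [in RHS](_ : sigma ^+ 2 = complex.Re (((sigma ^+ 2)%:C%:M :
    'M[R[i]]_M) j j)) -?E; last by rewrite mxE eqxx.
apply: eq_integral => t _ /=; rewrite ger0_norm ?addr_ge0 ?sqr_ge0//.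
by rewrite covE -sqr_cabs /energy; case: (w t j 0) => a b;
  rewrite /cabs /= sqr_sqrtr ?addr_ge0 ?sqr_ge0.
Qed.

(** Integrability comes from the pointwise bound |x| <= 1 + x^2. *)
Lemma noise_mean j : has_cmean (fun t => w t j 0) 0.
Proof.
have i1 : P.-integrable setT (EFin \o (fun t => 1 + energy j t)).
  exact: (integrableD measurableT
    (finite_measure_integrable_cst P 1 measurableT) (integrable_energy j)).
have le1 (x y : R) : `|x| <= 1 + (x ^+ 2 + y ^+ 2).
  by rewrite ler_norml; apply/andP; split; nra.
case: wn => _ /(_ j 0)[+ +] _; rewrite unlock mxE => r i.
split; split; [|exact: r| |exact: i].
- apply: integrable_dominated i1; first exact: mRe.
  by move=> t; exact: le1.
- apply: integrable_dominated i1; first exact: mIm.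
  by move=> t; rewrite /energy [X in 1 + X]addrC; exact: le1.
Qed.

(** Integrability comes from |x y| <= x^2 + y^2, applied to the real and imaginary
    parts. *)
Lemma noise_covariance j l :
  has_cmean (fun t => w t j 0 * conjc (w t l 0))
            ((sigma ^+ 2)%:C *+ (j == l)).
Proof.
have i1 : P.-integrable setT (EFin \o (fun t => energy j t + energy l t)).
  exact: (integrableD measurableT (integrable_energy j) (integrable_energy l)).
case: wn => _ _ /(_ j l)[]; rewrite unlock => r i.
rewrite (_ : _ *+ _ = ((sigma ^+ 2)%:C%:M : 'M[R[i]]_M) j l); last by rewrite mxE.
have reE t : complex.Re (w t j 0 * conjc (w t l 0)) =
    complex.Re (w t j 0) * complex.Re (w t l 0) +
    complex.Im (w t j 0) * complex.Im (w t l 0).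
  by case: (w t j 0) => ? ?; case: (w t l 0) => ? ? /=; rewrite mulrN opprK.
have imE t : complex.Im (w t j 0 * conjc (w t l 0)) =
    complex.Im (w t j 0) * complex.Re (w t l 0) -
    complex.Re (w t j 0) * complex.Im (w t l 0).
  case: (w t j 0) => ? ?; case: (w t l 0) => ? ? /=.
  by rewrite mulrN addrC.
have dot_le (a b c e : R) :
    `|a * b + c * e| <= a ^+ 2 + c ^+ 2 + (b ^+ 2 + e ^+ 2).
  have := sqr_ge0 (a + b); have := sqr_ge0 (a - b).
  have := sqr_ge0 (c + e); have := sqr_ge0 (c - e).
  by rewrite ler_norml => *; apply/andP; split; nra.
split; split.
- apply: integrable_dominated i1 => [|t] /=.
    rewrite (_ : _ \o _ = fun t => complex.Re (w t j 0) * complex.Re (w t l 0) +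
      complex.Im (w t j 0) * complex.Im (w t l 0)); last exact/funext.
    by apply: measurable_funD; apply: measurable_funM.
  by rewrite reE /energy; exact: dot_le.
- by rewrite -r; apply: eq_integral => t _; rewrite covE.
- apply: integrable_dominated i1 => [|t] /=.
    rewrite (_ : _ \o _ = fun t => complex.Im (w t j 0) * complex.Re (w t l 0) -
      complex.Re (w t j 0) * complex.Im (w t l 0)); last exact/funext.
    by apply: measurable_funB; apply: measurable_funM.
  rewrite imE /energy -mulNr [X in _ <= X + _]addrC.
  by rewrite -[X in _ <= _ + X + _]sqrrN; exact: dot_le.
- by rewrite -i; apply: eq_integral => t _; rewrite covE.
Qed.

(** In the expansion of the square, the terms linear in the noise vanish because
    it is centred, and the quadratic ones keep only their diagonal because its
    covariance is scalar. *)
Lemma expectation_sqr_norm2 n (A : 'M[R[i]]_(n, M)) (b : 'cV[R[i]]_n) :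
  has_mean (fun t => norm2 (b + A *m w t) ^+ 2)
    (norm2 b ^+ 2 + sigma ^+ 2 * \sum_k \sum_j cabs (A k j) ^+ 2).
Proof.
have row k : has_cmean (fun t => (b + A *m w t) k 0 * conjc ((b + A *m w t) k 0))
    (b k 0 * conjc (b k 0) +
     (sigma ^+ 2)%:C * \sum_j A k j * conjc (A k j)).
  rewrite (_ : (fun _ => _) = fun t =>
      b k 0 * conjc (b k 0) +
      (conjc (b k 0) * \sum_j A k j * w t j 0 +
       (b k 0 * conjc (\sum_j A k j * w t j 0) +
        \sum_j \sum_l A k j * conjc (A k l) * (w t j 0 * conjc (w t l 0)))));
    last first.
    apply/funext => t; rewrite !mxE.
    rewrite (_ : \sum_j \sum_l _ =
        (\sum_j A k j * w t j 0) * conjc (\sum_j A k j * w t j 0)).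
      by rewrite rmorphD/=; ring.
    rewrite rmorph_sum mulr_suml; apply: eq_bigr => j _.
    by rewrite mulr_sumr; apply: eq_bigr => l _; rewrite rmorphM/=; ring.
  rewrite (_ : _ + _ = b k 0 * conjc (b k 0) +
      (conjc (b k 0) * \sum_j A k j * 0 +
       (b k 0 * conjc (\sum_j A k j * 0) +
        \sum_j \sum_l A k j * conjc (A k l) *
           ((sigma ^+ 2)%:C *+ (j == l))))); last first.
    move: ((sigma ^+ 2)%:C) => s.
    have -> : \sum_j A k j * 0 = 0 by apply: big1 => j _; rewrite mulr0.
    rewrite conjc0 !mulr0 !add0r; congr (_ + _).
    rewrite mulr_sumr; apply: eq_bigr => j _.
    rewrite [RHS](bigD1 j)//= [X in _ + X]big1 => [|l lj].
      by rewrite addr0 eqxx mulr1n mulrC.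
    by rewrite eq_sym (negbTE lj) mulr0n mulr0.
  have lin : has_cmean (fun t => \sum_j A k j * w t j 0) (\sum_j A k j * 0).
    by apply: has_cmean_sum => j; apply: has_cmeanM; exact: noise_mean.
  apply: has_cmeanD; first exact: has_cmean_cst.
  apply: has_cmeanD; first exact: has_cmeanM.
  apply: has_cmeanD; first by apply: has_cmeanM; exact: has_cmean_conj.
  apply: has_cmean_sum => j; apply: has_cmean_sum => l.
  by apply: has_cmeanM; exact: noise_covariance.
have [+ _] := has_cmean_sum row.
rewrite (_ : complex.Re _ =
    norm2 b ^+ 2 + sigma ^+ 2 * \sum_k \sum_j cabs (A k j) ^+ 2).
  rewrite (_ : _ \o _ = fun t => norm2 (b + A *m w t) ^+ 2)//.
  by apply/funext => t; rewrite /= Re_sum sqr_norm2.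
rewrite Re_sum sqr_norm2 mulr_sumr -big_split/=; apply: eq_bigr => k _.
rewrite (_ : complex.Re (_ + _) = complex.Re (b k 0 * conjc (b k 0)) +
  complex.Re ((sigma ^+ 2)%:C * \sum_j A k j * conjc (A k j)));
  last by case: (_ * _) => ? ?; case: (_ * _).
congr (_ + _).
rewrite (_ : \sum_j cabs (A k j) ^+ 2 =
    complex.Re (\sum_j A k j * conjc (A k j))).
  by case: (\sum_j _) => x y /=; rewrite mul0r subr0.
by rewrite Re_sum; apply: eq_bigr => j _; rewrite sqr_cabs.
Qed.

End Mean.

(** * Derivatives of complex-valued functions of a real variable *)

Section ComplexDerivative.
Context {R : realType}.
Implicit Types (f g : R -> R[i]) (x : R) (z : R[i]).

Definition is_cderive f x z :=
  is_derive x 1 (fun t => complex.Re (f t)) (complex.Re z) /\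
  is_derive x 1 (fun t => complex.Im (f t)) (complex.Im z).

Lemma cderiveE f x z : is_cderive f x z -> cderive f x = z.
Proof.
move=> [fr fi]; rewrite /cderive !derive1E !derive_val.
by case: z {fr fi}.
Qed.

Lemma is_cderive_eq f x z z' : is_cderive f x z -> z = z' -> is_cderive f x z'.
Proof. by move=> ? <-. Qed.

Lemma is_cderive_cst c x : is_cderive (fun=> c) x 0.
Proof. by split; exact: is_derive_cst. Qed.

Lemma is_cderiveD f g x z1 z2 : is_cderive f x z1 -> is_cderive g x z2 ->
  is_cderive (fun t => f t + g t) x (z1 + z2).
Proof.
move=> [fr fi] [gr gi]; split.
- rewrite (_ : complex.Re _ = complex.Re z1 + complex.Re z2);
    last by case: z1 {fr fi} => ? ?; case: z2 {gr gi}.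
  rewrite (_ : (fun t => _) = fun t => complex.Re (f t) + complex.Re (g t));
    last by apply/funext => t; case: (f t) => ? ?; case: (g t).
  exact: is_deriveD.
- rewrite (_ : complex.Im _ = complex.Im z1 + complex.Im z2);
    last by case: z1 {fr fi} => ? ?; case: z2 {gr gi}.
  rewrite (_ : (fun t => _) = fun t => complex.Im (f t) + complex.Im (g t));
    last by apply/funext => t; case: (f t) => ? ?; case: (g t).
  exact: is_deriveD.
Qed.

Lemma is_cderiveM f g x z1 z2 : is_cderive f x z1 -> is_cderive g x z2 ->
  is_cderive (fun t => f t * g t) x (z1 * g x + f x * z2).
Proof.
move=> [fr fi] [gr gi]; split.
- rewrite (_ : (fun t => _) = fun t => complex.Re (f t) * complex.Re (g t) -
      complex.Im (f t) * complex.Im (g t));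
    last by apply/funext => t; case: (f t) => ? ?; case: (g t).
  refine (is_derive_eq (is_deriveB (is_deriveM fr gr) (is_deriveM fi gi)) _).
  rewrite /GRing.scale/=.
  case: z1 {fr fi} => ? ?; case: z2 {gr gi} => ? ?; case: (f x) => ? ?.
  by case: (g x) => ? ? /=; ring.
- rewrite (_ : (fun t => _) = fun t => complex.Re (f t) * complex.Im (g t) +
      complex.Im (f t) * complex.Re (g t));
    last by apply/funext => t; case: (f t) => ? ?; case: (g t).
  refine (is_derive_eq (is_deriveD (is_deriveM fr gi) (is_deriveM fi gr)) _).
  rewrite /GRing.scale/=.
  case: z1 {fr fi} => ? ?; case: z2 {gr gi} => ? ?; case: (f x) => ? ?.
  by case: (g x) => ? ? /=; ring.
Qed.

Lemma is_cderive_sum n (f : 'I_n -> R -> R[i]) x (z : 'I_n -> R[i]) :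
  (forall i, is_cderive (f i) x (z i)) ->
  is_cderive (fun t => \sum_i f i t) x (\sum_i z i).
Proof.
elim: n f z => [|n IHn] f z fz.
  rewrite big_ord0 (_ : (fun _ => _) = (fun=> 0)); first exact: is_cderive_cst.
  by apply/funext => t; rewrite big_ord0.
rewrite big_ord_recl (_ : (fun _ => _) =
    (fun t => f ord0 t + \sum_i f (lift ord0 i) t)).
  by apply: is_cderiveD => //; apply: IHn.
by apply/funext => t; rewrite big_ord_recl.
Qed.

Lemma is_cderive_conj f x z :
  is_cderive f x z -> is_cderive (fun t => conjc (f t)) x (conjc z).
Proof.
move=> [fr fi]; split.
- rewrite (_ : complex.Re _ = complex.Re z); last by case: z {fr fi}.
  rewrite (_ : (fun t => _) = fun t => complex.Re (f t))//.
  by apply/funext => t; case: (f t).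
- rewrite (_ : complex.Im _ = - complex.Im z); last by case: z {fr fi}.
  rewrite (_ : (fun t => _) = fun t => - complex.Im (f t)); first exact: is_deriveN.
  by apply/funext => t; case: (f t).
Qed.

Lemma is_cderive_expi (a b x : R) :
  is_cderive (fun t => expi (a * t + b)) x ((0 +i* a) * expi (a * x + b)).
Proof.
have aff : is_derive x 1 (fun t => a * t + b) a.
  have := is_deriveD (is_deriveZ a (is_derive_id x 1)) (is_derive_cst b x 1).
  by rewrite addr0 /GRing.scale/= mulr1.
split.
  refine (is_derive_eq (is_derive1_comp (is_derive_cos _) aff) _).
  by rewrite /= mul0r sub0r mulNr mulrC.
refine (is_derive_eq (is_derive1_comp (is_derive_sin _) aff) _).
by rewrite /= mul0r add0r mulrC.
Qed.

Lemma is_derive_sqr_cabs f x z : is_cderive f x z ->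
  is_derive x 1 (fun t => complex.Re (f t * conjc (f t)))
    (2 * complex.Re (conjc (f x) * z)).
Proof.
move=> fz; have [+ _] := is_cderiveM fz (is_cderive_conj fz).
move=> h; apply: is_derive_eq h _.
by case: (f x) => ? ?; case: z {fz} => ? ? /=; ring.
Qed.

End ComplexDerivative.

(** * The sampling matrix *)

Section Sampling.
Context {R : realType} {N M : nat}.
Implicit Types (u : 'cV[R[i]]_N) (Xi : 'rV[R]_M) (x : R).
Implicit Types (k : 'I_N) (j m : 'I_M).

Definition omega k : R := 2 * pi * freq k / N%:R.

Definition invsqrt : R := (Num.sqrt N%:R)^-1.

Definition duhat u x : R[i] :=
  invsqrt%:C *
    \sum_k u k 0 * ((0 +i* (- omega k)) * expi (- (2 * pi * x * freq k / N%:R))).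

(** The affine reparametrization covers both the derivative of uhat itself
    (e = 1) and its variation when the sampling point moves (e = 1) or stays fixed
    (e = 0) along a coordinate line. *)
Lemma is_cderive_uhat u (e x h : R) :
  is_cderive (fun t => uhat u (e * t + x)) h (e%:C * duhat u (e * h + x)).
Proof.
pose a k := - (e * omega k); pose b k := - (x * omega k).
have phaseE k t : - (2 * pi * (e * t + x) * freq k / N%:R) = a k * t + b k.
  by rewrite /a /b /omega; ring.
rewrite (_ : (fun t => _) = fun t =>
    invsqrt%:C * \sum_k u k 0 * expi (a k * t + b k)); last first.
  by apply/funext => t; congr (_ * _); apply: eq_bigr => k _; rewrite phaseE.
apply: is_cderive_eq.
  apply: is_cderiveM; first exact: is_cderive_cst.
  apply: is_cderive_sum => k; apply: is_cderiveM; first exact: is_cderive_cst.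
  exact: is_cderive_expi.
rewrite mul0r add0r /duhat mulrCA; congr (_ * _).
rewrite mulr_sumr; apply: eq_bigr => k _; rewrite mul0r add0r phaseE.
rewrite (_ : 0 +i* a k = e%:C * (0 +i* - omega k)); first by ring.
by apply/eqP; rewrite eq_complex /= /a; apply/andP; split; apply/eqP; ring.
Qed.

Lemma cderive_uhat u x : cderive (uhat u) x = duhat u x.
Proof.
apply: cderiveE; have := is_cderive_uhat u 1 0 x.
rewrite mul1r addr0 (_ : 1%:C = 1)// mul1r.
rewrite (_ : (fun t => _) = uhat u)//.
by apply/funext => t; rewrite mul1r addr0.
Qed.

Lemma samp_mx_conj Xi k j :
  conjc (samp_mx Xi k j) =
  invsqrt%:C * expi (- (2 * pi * Xi 0 j * freq k / N%:R)).
Proof.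
by rewrite mxE rmorphM -conj_expi; congr (_ * _); exact: conjc_real.
Qed.

Lemma uhat_vecE Xi u j :
  (adjmx (samp_mx Xi) *m u) j 0 = uhat u (Xi 0 j).
Proof.
rewrite mxE /uhat mulr_sumr; apply: eq_bigr => k _.
by rewrite mxE mxE samp_mx_conj -mulrA [expi _ * _]mulrC.
Qed.

Lemma cabs_samp_mx Xi k j : cabs (samp_mx Xi k j) = invsqrt.
Proof. by rewrite mxE cabsM cabs_real cabs_expi mulr1 ger0_norm// invr_ge0. Qed.

Definition residual u Xi : 'cV[R[i]]_N :=
  samp_mx Xi *m (adjmx (samp_mx Xi) *m u) - u.

Lemma residualE u Xi k :
  residual u Xi k 0 = \sum_j samp_mx Xi k j * uhat u (Xi 0 j) - u k 0.
Proof.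
by rewrite !mxE; congr (_ - _); apply: eq_bigr => j _; rewrite uhat_vecE.
Qed.

Lemma sqr_invsqrt : (0 < N)%N -> invsqrt ^+ 2 * N%:R = 1.
Proof.
move=> N0; rewrite /invsqrt exprVn sqr_sqrtr ?ler0n// mulVf// pnatr_eq0.
by rewrite -lt0n.
Qed.

(** The unit norm of the columns is what makes the noise contribution to the cost
    independent of the configuration. *)
Lemma sum_sqr_cabs_samp_mx Xi : (0 < N)%N ->
  \sum_(k < N) \sum_j cabs (samp_mx Xi k j) ^+ 2 = M%:R.
Proof.
move=> N0; rewrite (eq_bigr (fun=> M%:R * invsqrt ^+ 2)) => [|k _].
  rewrite sumr_const card_ord -[LHS]mulr_natr -mulrA sqr_invsqrt//.
  by rewrite mulr1.
rewrite (eq_bigr (fun=> invsqrt ^+ 2)) => [|j _]; last by rewrite cabs_samp_mx.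
by rewrite sumr_const card_ord -[LHS]mulr_natl.
Qed.

(** The argument of the norm in the cost is the residual plus the image of the
    noise under the sampling matrix. *)
Lemma J1E (sigma : R) (d : measure_display) (T : measurableType d)
    (P : probability T R) (w : T -> 'cV[R[i]]_M) u Xi :
  (0 < N)%N -> white_gaussian_noise P sigma w ->
  J1 P w u Xi = 2^-1 * (norm2 (residual u Xi) ^+ 2 + sigma ^+ 2 * M%:R).
Proof.
move=> N0 wn; rewrite /J1 unlock.
have [_] := has_meanZ 2^-1
  (expectation_sqr_norm2 wn (samp_mx Xi) (residual u Xi)).
rewrite sum_sqr_cabs_samp_mx// => h.
rewrite -[RHS]/(fine (EFin _)) -h; congr fine.
apply: eq_integral => t _; congr ((_ * norm2 _ ^+ 2)%:E).
by rewrite mulmxDr /residual addrAC.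
Qed.

(** The m-th point appears in the m-th column of the sampling matrix and in the
    m-th sample, and nowhere else: the other terms of the sum over the points have
    derivative zero. *)
Lemma is_cderive_residual u Xi m k :
  is_cderive (fun h => residual u (h *: delta_mx 0 m + Xi) k 0) 0
    ((0 +i* omega k) * samp_mx Xi k m * uhat u (Xi 0 m) +
     samp_mx Xi k m * duhat u (Xi 0 m)).
Proof.
pose e j : R := (j == m)%:R.
have XiE j h : (h *: delta_mx 0 m + Xi) 0 j = e j * h + Xi 0 j.
  by rewrite !mxE /= mulrC.
have phaseE j h : 2 * pi * (e j * h + Xi 0 j) * freq k / N%:R =
    e j * omega k * h + Xi 0 j * omega k.
  by rewrite /omega; ring.
have phase0 j : 2 * pi * Xi 0 j * freq k / N%:R = Xi 0 j * omega k.
  by rewrite /omega; ring.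
rewrite (_ : (fun h => _) = fun h =>
    \sum_j (invsqrt%:C * expi (e j * omega k * h + Xi 0 j * omega k)) *
           uhat u (e j * h + Xi 0 j) + (- u k 0)); last first.
  apply/funext => h; rewrite residualE; congr (_ - _).
  by apply: eq_bigr => j _; rewrite [samp_mx _ _ _]mxE XiE phaseE.
apply: is_cderive_eq.
  apply: is_cderiveD; last exact: is_cderive_cst.
  apply: is_cderive_sum => j; apply: is_cderiveM; last exact: is_cderive_uhat.
  by apply: is_cderiveM; [exact: is_cderive_cst|exact: is_cderive_expi].
rewrite addr0 (bigD1 m)//= [X in _ + X]big1 => [|j jm].
  rewrite /e eqxx !mulr0 !add0r !mul1r mul0r add0r addr0.
  by rewrite [samp_mx _ _ _]mxE phase0; ring.
by rewrite /e (negbTE jm) !(mul0r, mulr0, addr0).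
Qed.

(** The partial derivative of the cost: the real pairing of the residual with
    its own derivative. *)
Definition dcost u Xi m : R :=
  complex.Re (\sum_k conjc (residual u Xi k 0) *
    ((0 +i* omega k) * samp_mx Xi k m * uhat u (Xi 0 m) +
     samp_mx Xi k m * duhat u (Xi 0 m))).

Lemma is_derive_J1 (sigma : R) (d : measure_display) (T : measurableType d)
    (P : probability T R) (w : T -> 'cV[R[i]]_M) u Xi m :
  (0 < N)%N -> white_gaussian_noise P sigma w ->
  is_derive (0 : R) 1 (fun h => J1 P w u (h *: delta_mx 0 m + Xi)) (dcost u Xi m).
Proof.
move=> N0 wn.
rewrite (_ : (fun h => _) = (2^-1 : R) \*: (\sum_k (fun h : R =>
   complex.Re (residual u (h *: delta_mx 0 m + Xi) k 0 *
     conjc (residual u (h *: delta_mx 0 m + Xi) k 0))) +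
   cst (sigma ^+ 2 * M%:R))); last first.
  apply/funext => h; rewrite (J1E u _ N0 wn) sqr_norm2.
  rewrite /GRing.scale/=; congr (_ * (_ + _)).
  by rewrite fct_sumE.
have dsum := is_derive_sum
  (fun k => is_derive_sqr_cabs (is_cderive_residual u Xi m k)).
refine (is_derive_eq (is_deriveZ _ (is_deriveD dsum (is_derive_cst _ _ _))) _).
rewrite addr0 /dcost Re_sum -mulr_sumr scale0r add0r.
by rewrite /GRing.scale/= mulKf// pnatr_eq0.
Qed.

End Sampling.

(** * Bound on the partial derivatives *)

Section GradientBound.
Context {R : realType} {N M : nat}.
Implicit Types (u : 'cV[R[i]]_N) (Xi : 'rV[R]_M) (x : R).
Implicit Types (k : 'I_N) (j m : 'I_M).

(** For even N the frequencies are the integers of [-N/2, N/2[, whence pi. *)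
Lemma omega_le_pi k : ~~ odd N -> `|omega k : R| <= pi.
Proof.
move=> evN; have N0 : 0 < (N%:R : R) by rewrite ltr0n (leq_ltn_trans _ (ltn_ord k)).
have NE : (N%:R : R) = 2 * (N./2)%:R.
  by rewrite -[in LHS](even_halfK evN) -mul2n natrM.
have k0 : 0 <= ((k : nat)%:R : R) by [].
have kN : (k : nat)%:R <= (N%:R : R) by rewrite ler_nat ltnW.
rewrite /omega normrM normfV (gtr0_norm N0) ler_pdivrMr//.
rewrite normrM [`|2 * _|]ger0_norm ?mulr_ge0 ?pi_ge0// [2 * _]mulrC -mulrA.
apply: ler_wpM2l; first exact: pi_ge0.
rewrite -[2]ger0_norm// -normrM /freq ler_norml.
by apply/andP; split; lra.
Qed.

(** The synthesis part of the residual is a combination of the columns of the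
    sampling matrix weighted by the samples, hence the one-norm of the samples;
    only the signal itself contributes a term without that factor. *)
Lemma residual_pairing_le u Xi (a : 'I_N -> R[i]) (K : R) : (0 < N)%N ->
  (forall k, cabs (a k) <= K * @invsqrt R N) ->
  cabs (\sum_k conjc (residual u Xi k 0) * a k) <=
    K * norm1 (uhat_vec Xi u) + cabs (\sum_k conjc (u k 0) * a k).
Proof.
move=> N0 aK.
have -> : \sum_k conjc (residual u Xi k 0) * a k =
    (\sum_j conjc (uhat u (Xi 0 j)) * \sum_k conjc (samp_mx Xi k j) * a k) +
    - \sum_k conjc (u k 0) * a k.
  under eq_bigr => k _ do rewrite residualE rmorphB/= rmorph_sum mulrBl mulr_suml.
  rewrite sumrB; congr (_ - _); rewrite exchange_big; apply: eq_bigr => j _.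
  by rewrite mulr_sumr; apply: eq_bigr => k _; rewrite rmorphM/= mulrCA !mulrA.
apply: (le_trans (cabsD_le _ _)); rewrite cabsN lerD2r.
apply: (le_trans (cabs_sum_le _ _ _)); rewrite /norm1 mulr_sumr.
apply: ler_sum => j _; rewrite cabsM cabs_conj /uhat_vec uhat_vecE mulrC.
apply: ler_wpM2r; first exact: cabs_ge0.
apply: (le_trans (cabs_sum_le _ _ _)).
apply: (@le_trans _ _ (\sum_(k < N) K * @invsqrt R N ^+ 2)).
  apply: ler_sum => k _; rewrite cabsM cabs_conj cabs_samp_mx mulrC expr2 mulrA.
  by apply: ler_wpM2r => //; rewrite invr_ge0 sqrtr_ge0.
by rewrite sumr_const card_ord -[leLHS]mulr_natr -mulrA sqr_invsqrt// mulr1.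
Qed.

Lemma signal_column u Xi m :
  \sum_k conjc (u k 0) * samp_mx Xi k m = conjc (uhat u (Xi 0 m)).
Proof.
rewrite -(conjcK (\sum_k _)); congr conjc; rewrite rmorph_sum -uhat_vecE mxE.
apply: eq_bigr => k _; rewrite rmorphM [in RHS]mxE [in RHS]mxE [RHS]mulrC.
by congr (_ * _); exact: conjcK.
Qed.

Lemma signal_dcolumn u Xi m :
  \sum_k conjc (u k 0) * ((0 +i* omega k) * samp_mx Xi k m) =
  conjc (duhat u (Xi 0 m)).
Proof.
rewrite -(conjcK (\sum_k _)); congr conjc; rewrite rmorph_sum /duhat mulr_sumr.
apply: eq_bigr => k _; rewrite !rmorphM.
rewrite -[LHS]/(conjc (conjc (u k 0)) *
  ((0 +i* - omega k) * conjc (samp_mx Xi k m))).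
by rewrite conjcK samp_mx_conj; ring.
Qed.

(** Each of the three products |v_m| |v|_1, |v_m'| |v|_1 and |v_m| |v_m'| is at
    most D |v|_1, and they occur with total weight 3 + pi. *)
Lemma dcost_le u Xi m (D : R) : (0 < N)%N -> ~~ odd N ->
  cabs (uhat u (Xi 0 m)) <= D -> cabs (cderive (uhat u) (Xi 0 m)) <= D ->
  `|dcost u Xi m| <= (3 + pi) * (D * norm1 (uhat_vec Xi u)).
Proof.
rewrite cderive_uhat => N0 evN vD v'D.
set v := uhat u _ in vD *; set v' := duhat u _ in v'D *.
set n1 := norm1 _.
have vn1 : cabs v <= n1.
  rewrite /n1 /norm1 (bigD1 m)//= /uhat_vec uhat_vecE lerDl.
  by apply: sumr_ge0 => j _; exact: cabs_ge0.
have v0 := cabs_ge0 v; have v'0 := cabs_ge0 v'; have pi0 := pi_ge0 R.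
apply: (le_trans (Re_le_cabs _)).
have -> : \sum_k conjc (residual u Xi k 0) *
      ((0 +i* omega k) * samp_mx Xi k m * v + samp_mx Xi k m * v') =
    (\sum_k conjc (residual u Xi k 0) * ((0 +i* omega k) * samp_mx Xi k m)) * v +
    (\sum_k conjc (residual u Xi k 0) * samp_mx Xi k m) * v'.
  by rewrite !mulr_suml -big_split/=; apply: eq_bigr => k _; ring.
apply: (le_trans (cabsD_le _ _)); rewrite (cabsM _ v) (cabsM _ v').
have h1 : cabs (\sum_k conjc (residual u Xi k 0) *
    ((0 +i* omega k) * samp_mx Xi k m)) <= pi * n1 + cabs v'.
  rewrite -(cabs_conj v') -signal_dcolumn; apply: residual_pairing_le => // k.
  rewrite cabsM cabs_samp_mx; apply: ler_wpM2r; first by rewrite invr_ge0 sqrtr_ge0.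
  by rewrite /cabs /= expr0n /= add0r sqrtr_sqr omega_le_pi.
have h2 : cabs (\sum_k conjc (residual u Xi k 0) * samp_mx Xi k m) <=
    1 * n1 + cabs v.
  rewrite -(cabs_conj v) -signal_column; apply: residual_pairing_le => // k.
  by rewrite cabs_samp_mx mul1r.

apply: (le_trans (lerD (ler_wpM2r v0 h1) (ler_wpM2r v'0 h2))).
have : cabs v * n1 <= D * n1 by apply: ler_wpM2r => //; exact: le_trans vn1.
have : cabs v' * n1 <= D * n1 by apply: ler_wpM2r => //; exact: le_trans vn1.
have : cabs v * cabs v' <= n1 * cabs v' by apply: ler_wpM2r.
move=> a1 a2 a3; have := ler_wpM2l pi0 a3.
nra.
Qed.

End GradientBound.

(** * The minimal distance *)

Section MinDistance.
Context {R : realType}.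
Implicit Types x y : R.

Let lower0 (N : nat) x y :
  lbound [set `|x - y - k%:~R * N%:R| | k in [set: int]] 0.
Proof. by move=> _ [k _ <-]. Qed.

Lemma torus_dist_ge0 N x y : 0 <= torus_dist N x y.
Proof.
by apply: lb_le_inf => //; exists `|x - y - 0%:~R * N%:R|; exists 0.
Qed.

Lemma torus_dist_le_norm N x y : torus_dist N x y <= `|x - y|.
Proof.
apply: ge_inf; first by exists 0.
by exists 0 => //; rewrite mul0r subr0.
Qed.

(** The translates of x - y by multiples of N stay at distance at least
    min(|x - y|, N - |x - y|) from 0, which bounds the infimum away from 0. *)
Lemma torus_dist_gt0 N x y : x != y -> `|x - y| < N%:R ->
  0 < torus_dist N x y.
Proof.
move=> xy lt_xyN; set D := x - y.
apply: (@lt_le_trans _ _ (Num.min `|D| (N%:R - `|D|))).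
  by rewrite lt_min normr_gt0 subr_eq0 xy subr_gt0.
apply: lb_le_inf; first by exists `|D - 0%:~R * N%:R|; exists 0.
move=> _ [k _ <-]; rewrite ge_min -/D.
have N0 : 0 <= (N%:R : R) by [].
have Dl := ler_norm D; have Dr := lerNnormlW (lexx `|D|).
case: (ltrgtP k 0) => [kneg|kpos|->]; last by rewrite mul0r subr0 lexx.
- apply/orP; right; have : (k%:~R : R) <= -1.
    by rewrite -[-1](mulrN1z 1) ler_int; move: kneg; case: k.
  move=> k1; apply: le_trans (ler_norm _); nra.
- apply/orP; right; have k1 : 1 <= (k%:~R : R) by rewrite ler1z.
  rewrite -[`|D - _|]normrN; apply: le_trans (ler_norm _); nra.
Qed.

(** Positivity holds because the infimum is over finitely many pairs, each at
    positive distance; the upper bound is the diameter of the interval. *)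
Lemma min_dist_itv N M (Xi : 'rV[R]_M) : (2 <= M)%N ->
  (forall m, Xi 0 m \in `[- (N%:R / 2), N%:R / 2[) ->
  injective (fun m : 'I_M => Xi 0 m) ->
  0 < min_dist N Xi <= N%:R.
Proof.
move=> M2 XiN injXi.
pose p01 : 'I_M * 'I_M := (Ordinal (ltnW M2), Ordinal M2).
have p01P : p01.1 != p01.2 by [].
have ltN (p : 'I_M * 'I_M) : `|Xi 0 p.1 - Xi 0 p.2| < N%:R.
  have := XiN p.1; have := XiN p.2; rewrite !in_itv/= => /andP[? ?] /andP[? ?].
  by rewrite ltr_norml; apply/andP; split; lra.
have N0 : 0 < (N%:R : R) by exact: le_lt_trans (ltN p01).
apply/andP; split.
  pose F (p : 'I_M * 'I_M) := torus_dist N (Xi 0 p.1) (Xi 0 p.2).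
  apply: (@lt_le_trans _ _ (\big[Num.min/N%:R]_(p | p.1 != p.2) F p)).
    apply: lt_bigmin => // p pP; apply: torus_dist_gt0 => //.
    by apply: contra pP => /eqP/injXi/eqP.
  apply: lb_le_inf; first by exists (F p01); exists p01.
  by move=> _ [p pP <-]; exact: bigmin_le_cond.
apply: (@le_trans _ _ (torus_dist N (Xi 0 p01.1) (Xi 0 p01.2))).
  apply: ge_inf; last by exists p01.
  by exists 0 => _ [p _ <-]; exact: torus_dist_ge0.
by apply: le_trans (torus_dist_le_norm _ _ _) _; exact: ltW.
Qed.

End MinDistance.

(** * The gradient estimate *)

Lemma derivative_along_line {R : realType} M (f : 'rV[R]_M -> R) Xi m (z : R) :
  is_derive (0 : R) 1 (fun h => f (h *: delta_mx 0 m + Xi)) z ->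
  derivable f Xi (delta_mx 0 m) /\ partial_at f Xi m = z.
Proof.
move=> [df <-]; split; first exact/derivable1P.
rewrite /partial_at /derive; set g1 := fun h => h^-1 *: _.
set g2 := fun h => h^-1 *: _; suff -> : g1 = g2 by [].
by apply/funext => h; rewrite /g1 /g2 /= addr0 scale0r add0r [_%:A]mulr1.
Qed.

Unset Implicit Arguments.
Set Strict Implicit.

Theorem theorem2 (R : realType) (N M : nat) (alpha C : R)
    (hN0 : (0 < N)%N) (hN : ~~ odd N) (hM : (2 <= M)%N)
    (halpha : 0 < alpha) (hC : 0 < C) :
  exists C' : R, 0 < C' /\
    forall (sigma : R) (d : measure_display) (T : measurableType d)
      (P : probability T R) (w : T -> 'cV[R[i]]_M)
      (u : 'cV[R[i]]_N) (Xi : 'rV[R]_M),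
      0 <= sigma ->
      white_gaussian_noise P sigma w ->
      (forall xi : R, xi \in `[- (N%:R / 2), N%:R / 2[ -> xi != 0 ->
         cabs (uhat u xi) <= C / `|xi| `^ alpha /\
         cabs (cderive (uhat u) xi) <= C / `|xi| `^ alpha) ->
      (forall m : 'I_M, Xi 0 m \in `[- (N%:R / 2), N%:R / 2[) ->
      injective (fun m : 'I_M => Xi 0 m) ->
      forall m : 'I_M, Xi 0 m != 0 ->
        derivable (J1 P w u) Xi (delta_mx 0 m) /\
        `|partial_at (J1 P w u) Xi m| <=
          C' * (norm1 (uhat_vec Xi u) /
                (min_dist N Xi * `|Xi 0 m| `^ alpha)).
Proof.
have pi0 := pi_ge0 R; have NR : 0 < (N%:R : R) by rewrite ltr0n.
exists ((3 + pi) * C * N%:R); split.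
  by rewrite !mulr_gt0// ltr_wpDr.
move=> sigma d T P w u Xi _ wn decay XiN injXi m Xim0.
have [dJ ->] := derivative_along_line (is_derive_J1 u Xi m hN0 wn).
split=> //; have [vD v'D] := decay _ (XiN m) Xim0.
apply: (le_trans (dcost_le hN0 hN vD v'D)).
have /andP[md0 mdN] := min_dist_itv hM XiN injXi.
set q := `|_| `^ alpha.
have q0 : 0 < q by rewrite powR_gt0// normr_gt0.
have n10 : 0 <= norm1 (uhat_vec Xi u).
  by apply: sumr_ge0 => j _; exact: cabs_ge0.
rewrite -!mulrA; apply: ler_wpM2l; first exact: addr_ge0.
apply: ler_wpM2l; first exact: ltW.
rewrite [q^-1 * _]mulrC invfM !mulrA; apply: ler_wpM2r.
  by rewrite invr_ge0 ltW.
by rewrite ler_pdivlMr// mulrC; apply: ler_wpM2r.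
Qed.
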